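(* Let $b\ge2$, $s\ge1$, $n\ge1$ be integers, let $P\subset\mathbb{Z}_b^{s\times n}$ be a subgroup, let $f\colon[0,1)^s\to\mathbb{R}$ be Riemann integrable, and let $f_n$ be its $n$-digit discretization. Then $$\mathrm{Var}_{\sigma\in\mathbb{Z}_b^{s\times n}}[I_{P+\sigma}(f_n)]=\sum_{A\in P^\perp\setminus\{0\}}\bigl|\widehat{f_n}(A)\bigr|^2 .$$
   Context: $\mathbb{Z}_b=\mathbb{Z}/b\mathbb{Z}$ is identified with $\{0,\dots,b-1\}$; $\mathbb{Z}_b^{s\times n}$ is the additive group of $s\times n$ matrices over $\mathbb{Z}_b$. For $X=(x_{i,j})\in\mathbb{Z}_b^{s\times n}$ let $I_n(X)=\prod_{i=1}^s\bigl[\sum_{j=1}^n x_{i,j}b^{-j},\ \sum_{j=1}^n x_{i,j}b^{-j}+b^{-n}\bigr)$; the $n$-digit discretization of $f$ is $f_n\colon\mathbb{Z}_b^{s\times n}\to\mathbb{R}$, $f_n(X)=\frac1{\mathrm{Vol}(I_n(X))}\int_{I_n(X)}f(\boldsymbol x)\,d\boldsymbol x$. With $\omega_b=\exp(2\pi\sqrt{-1}/b)$ and $A\bullet B=\omega_b^{\sum_{i,j}a_{i,j}b_{i,j}}$ for $A,B\in\mathbb{Z}_b^{s\times n}$, set $P^\perp=\{A\in\mathbb{Z}_b^{s\times n}\mid A\bullet B=1\text{ for all }B\in P\}$ and $\widehat{f_n}(A)=b^{-sn}\sum_{B\in\mathbb{Z}_b^{s\times n}}f_n(B)(A\bullet B)$.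 Also $P+\sigma=\{g+\sigma\mid g\in P\}$ and $I_{P+\sigma}(f_n)=|P|^{-1}\sum_{g\in P}f_n(g+\sigma)$; $\mathrm{Var}_{\sigma\in\mathbb{Z}_b^{s\times n}}$ is the variance with respect to $\sigma$ uniformly distributed on $\mathbb{Z}_b^{s\times n}$. *)

(* Defs.v *)
From HB Require Import structures.
From mathcomp Require Import all_boot all_order all_algebra.
From mathcomp Require Import complex.
From mathcomp Require Import all_classical all_reals.
From mathcomp Require Import numfun sequences exp trigo.

Set Implicit Arguments.
Unset Strict Implicit.
Unset Printing Implicit Defensive.

Import Order.TTheory GRing.Theory Num.Theory.

Local Open Scope ring_scope.
Local Open Scope complex_scope.

Section Riemann.
Variables (R : realType) (s : nat).
Implicit Types (u v : 'rV[R]_s) (f : 'rV[R]_s -> R) (p : 'I_s -> seq R).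

(* Functions on a half-open box are total functions on R^s of which only the
   values on the box are used. *)
Definition box u v : set 'rV[R]_s :=
  [set x | forall i, u 0 i <= x 0 i < v 0 i]%classic.

Definition box_volume u v : R := \prod_i (v 0 i - u 0 i).

(* A grid on box u v is given by a subdivision of each [u_i, v_i]; following
   [itv_partition], the list p i omits the left endpoint u_i and ends at v_i. *)
Definition grid u v p : Prop :=
  forall i, itv_partition (u 0 i) (v 0 i) (p i).

Definition cell_index p : finType := {dffun forall i : 'I_s, 'I_(size (p i))}.

Definition cell_lo u p (k : cell_index p) : 'rV[R]_s :=
  \row_i nth 0 (u 0 i :: p i) (k i).

Definition cell_hi p (k : cell_index p) : 'rV[R]_s := \row_i nth 0 (p i) (k i).

Definition lower_sum f u p : R :=
  \sum_(k : cell_index p) inf (f @` box (cell_lo u k) (cell_hi k))%classic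
                          * box_volume (cell_lo u k) (cell_hi k).

Definition upper_sum f u p : R :=
  \sum_(k : cell_index p) sup (f @` box (cell_lo u k) (cell_hi k))%classic
                          * box_volume (cell_lo u k) (cell_hi k).

Definition lower_integral f u v : R :=
  sup [set lower_sum f u p | p in grid u v]%classic.

Definition upper_integral f u v : R :=
  inf [set upper_sum f u p | p in grid u v]%classic.

(* Boundedness is required separately since [sup] and [inf] are junk values on
   unbounded sets. *)
Definition Riemann_integrable f u v : Prop :=
  (exists M : R, forall x, box u v x -> `|f x| <= M) /\
  lower_integral f u v = upper_integral f u v.

(* Meaningful when f is Riemann integrable on box u v. *)
Definition Riemann_integral f u v : R := lower_integral f u v.

End Riemann.

Section Digital.
Variables (R : realType) (b s n : nat).
Implicit Types (A B X : 'M['Z_b]_(s, n)) (P : {set 'M['Z_b]_(s, n)}).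

(* Column j : 'I_n carries the digit of weight b^-(j+1). *)
Definition In_lo X : 'rV[R]_s :=
  \row_i \sum_(j < n) (X i j : nat)%:R / b%:R ^+ j.+1.

Definition In_hi X : 'rV[R]_s := \row_i (In_lo X 0 i + b%:R ^- n).

Definition discretization (f : 'rV[R]_s -> R) X : R :=
  (box_volume (In_lo X) (In_hi X))^-1
  * Riemann_integral f (In_lo X) (In_hi X).

Definition expC (z : R[i]) : R[i] :=
  (expR (complex.Re z))%:C * (cos (complex.Im z) +i* sin (complex.Im z)).

Definition omega : R[i] := expC ((2 * pi / b%:R) *i).

Definition bullet A B : R[i] := omega ^+ (\sum_i \sum_j (A i j * B i j))%N.

Definition dual P : {set 'M['Z_b]_(s, n)} :=
  [set A | [forall B in P, bullet A B == 1]]%SET.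

Definition Fourier (g : 'M['Z_b]_(s, n) -> R) A : R[i] :=
  b%:R ^- (s * n) * \sum_B (g B)%:C * bullet A B.

Definition QMC P (sigma : 'M['Z_b]_(s, n)) (g : 'M['Z_b]_(s, n) -> R) : R :=
  #|P|%:R^-1 * \sum_(x in P) g (x + sigma).

End Digital.

Section Uniform.
Variables (R : realType) (T : finType).

Definition unif_mean (Y : T -> R) : R := #|T|%:R^-1 * \sum_x Y x.

Definition unif_variance (Y : T -> R) : R :=
  unif_mean (fun x => (Y x - unif_mean Y) ^+ 2).

End Uniform.

(* Main.v *)
(* The kernel [A, B |-> bullet A B] is a nondegenerate symmetric pairing of the
   finite abelian group of s x n digit matrices with itself, because omega is a
   primitive b-th root of unity. Averaging a function over translates by P
   multiplies its transform by the indicator of the dual of P, since a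
   nontrivial character of P sums to zero. Parseval then gives the variance as
   the sum of the squared moduli of the remaining coefficients, the one at 0
   being the mean. *)
Require Import Defs.
From mathcomp Require Import all_boot all_order all_algebra.
From mathcomp Require Import complex.
From mathcomp Require Import all_classical all_reals.
From mathcomp Require Import sequences exp trigo lra.

Import Order.TTheory GRing.Theory Num.Theory.

Local Open Scope ring_scope.
Local Open Scope complex_scope.

(** Translation by [x0] permutes [D], so the sum equals [phi x0] times itself and must vanish.
    Keeping [D] general serves both the whole group and the subgroup [P]. *)
Lemma sum_nontrivial_character (C : fieldType) (T : finZmodType) (D : {set T})
    (phi : T -> C) (x0 : T) :
    GRing.zmod_closed D -> {morph phi : x y / x + y >-> x * y} ->
  x0 \in D -> phi x0 != 1 -> \sum_(x in D) phi x = 0.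
Proof.
move=> [D0 DB] phiD Dx0 phi_x0.
have DN x : x \in D -> - x \in D by move=> Dx; rewrite -sub0r DB.
have DD x y : x \in D -> y \in D -> x + y \in D.
  by move=> Dx Dy; rewrite -[y]opprK DB ?DN.
have phiS : \sum_(x in D) phi x = phi x0 * \sum_(x in D) phi x.
  rewrite mulr_sumr [LHS](reindex_inj (addrI x0)); apply: eq_big => [x|x _].
    by apply/idP/idP=> [/(DD _ _ (DN _ Dx0))|/(DD _ _ Dx0)//]; rewrite addKr.
  exact: phiD.
apply/eqP; rewrite -[_ == 0]orFb -(negbTE phi_x0) -subr_eq0 -mulf_eq0.
by rewrite mulrBl mul1r -phiS subrr.
Qed.

Section FourierAnalysis.
Variables (C : numClosedFieldType) (T : finZmodType) (chi : T -> T -> C).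
Hypothesis chiC : forall A B, chi A B = chi B A.
Hypothesis chiD : forall A, {morph chi A : B1 B2 / B1 + B2 >-> B1 * B2}.
Hypothesis norm_chi : forall A B, `|chi A B| = 1.
Hypothesis chi_nondegenerate : forall B, B != 0 -> exists A, chi A B != 1.

Definition transform (g : T -> C) A : C :=
  #|T|%:R^-1 * \sum_B g B * chi A B.

Definition annihilator (P : {set T}) : {set T} :=
  [set A | [forall B in P, chi A B == 1]]%SET.

Lemma chi_neq0 A B : chi A B != 0.
Proof. by rewrite -normr_eq0 norm_chi oner_eq0. Qed.

Lemma chi0 A : chi A 0 = 1.
Proof. by apply: (mulfI (chi_neq0 A 0)); rewrite -chiD addr0 mulr1. Qed.

(** On the unit circle conjugation is inversion, and a character sends opposites to inverses. *)
Lemma conj_chi A B : (chi A B)^*%R = chi A (- B).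
Proof.
apply: (mulfI (chi_neq0 A B)).
by rewrite -normCK norm_chi expr1n -chiD subrr chi0.
Qed.

Lemma card_neq0 : #|T|%:R != 0 :> C.
Proof. by rewrite pnatr_eq0 -lt0n; apply/card_gt0P; exists 0. Qed.

(** By symmetry the summand is a character in [A], and nondegeneracy makes it nontrivial when [B] is
    nonzero. *)
Lemma sum_chi B : \sum_A chi A B = (#|T| * (B == 0))%:R.
Proof.
have [->|/chi_nondegenerate[A0 A0B]] := eqVneq B 0.
  by under eq_bigr do rewrite chi0; rewrite sumr_const muln1.
rewrite muln0 (eq_bigl [in [set: T]%SET]) => [|A]; last first.
  by rewrite finset.in_setT.
apply: (@sum_nontrivial_character _ _ _ (chi^~ B) A0) => //.
  by split=> [|A A' _ _]; rewrite !finset.in_setT.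
by move=> A A'; rewrite -!(chiC B) chiD.
Qed.

Lemma parseval (g : T -> C) :
  \sum_A `|transform g A| ^+ 2 = #|T|%:R^-1 * \sum_B `|g B| ^+ 2.
Proof.
have normE A : `|transform g A| ^+ 2 = #|T|%:R^-2 *
    \sum_B \sum_B' g B * (g B')^*%R * chi A (B - B').
  rewrite normCK /transform rmorphM rmorph_sum fmorphV /= conjC_nat.
  rewrite mulrACA -invfM -expr2 mulr_suml; congr (_ * _); apply: eq_bigr => B _.
  rewrite mulr_sumr; apply: eq_bigr => B' _.
  by rewrite rmorphM /= chiD -conj_chi mulrACA.
under eq_bigr do rewrite normE.
rewrite -mulr_sumr exchange_big /= -exprVn expr2 -mulrA; congr (_ * _).
rewrite mulr_sumr; apply: eq_bigr => B _.
(* Summing over [A] first, orthogonality leaves only the diagonal term [B' = B]. *)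
rewrite exchange_big /= (bigD1 B) //= -mulr_sumr subrr sum_chi eqxx muln1.
rewrite big1 => [|B' B'B]; last first.
  by rewrite -mulr_sumr sum_chi subr_eq0 eq_sym (negPf B'B) muln0 mulr0.
by rewrite addr0 mulrCA mulVf ?card_neq0 // mulr1 -normCK.
Qed.

Lemma transform0 (g : T -> C) : transform g 0 = #|T|%:R^-1 * \sum_B g B.
Proof. by congr (_ * _); apply: eq_bigr => B _; rewrite chiC chi0 mulr1. Qed.

(** The transform of a constant is concentrated at 0; this lets the mean be subtracted without
    touching the other coefficients. *)
Lemma transformB_cst (g : T -> C) (c : C) A :
  transform (fun B => g B - c) A = transform g A - c * (A == 0)%:R.
Proof.
rewrite /transform; under eq_bigr do rewrite mulrBl.
have -> : \sum_B (g B * chi A B - c * chi A B) =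
    \sum_B g B * chi A B - c * \sum_B chi B A.
  by rewrite sumrB mulr_sumr; congr (_ - _); apply: eq_bigr => B _;
    rewrite chiC.
by rewrite mulrBr sum_chi natrM mulrCA mulKf ?card_neq0.
Qed.

(** Parseval for [g] minus its mean: the mean is the coefficient at 0, so centering removes exactly
    that term. *)
Lemma variance_transform (g : T -> C) :
  #|T|%:R^-1 * \sum_B `|g B - #|T|%:R^-1 * \sum_B' g B'| ^+ 2
  = \sum_(A | A != 0) `|transform g A| ^+ 2.
Proof.
rewrite -transform0 -parseval (bigD1 0) //= transformB_cst eqxx mulr1 subrr.
rewrite normr0 expr0n add0r; apply: eq_bigr => A /negPf A0.
by rewrite transformB_cst A0 mulr0 subr0.
Qed.

Lemma sum_chi_subgroup (P : {set T}) A : GRing.zmod_closed P ->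
  \sum_(x in P) chi A x = #|P|%:R * (A \in annihilator P)%:R.
Proof.
move=> P_closed; rewrite inE; case: (boolP [forall B in P, _]) => [/forall_inP|].
  move=> chi1; rewrite mulr1 -sumr_const.
  by apply: eq_bigr => x Px; apply/eqP/chi1.
rewrite negb_forall_in => /exists_inP[x Px Ax].
by rewrite (@sum_nontrivial_character _ _ _ (chi A) x) ?mulr0.
Qed.

Lemma transform_translates (P : {set T}) (g : T -> C) A : GRing.zmod_closed P ->
  transform (fun y => #|P|%:R^-1 * \sum_(x in P) g (x + y)) A
  = transform g A * (A \in annihilator P)%:R.
Proof.
move=> P_closed; have P0 : #|P|%:R != 0 :> C.
  rewrite pnatr_eq0 -lt0n; apply/card_gt0P; exists 0; exact: P_closed.1.
rewrite /transform -mulrA; congr (_ * _).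
transitivity (#|P|%:R^-1 * \sum_(x in P) \sum_y g (x + y) * chi A y).
  rewrite exchange_big /= mulr_sumr; apply: eq_bigr => y _.
  by rewrite -mulrA mulr_suml.
transitivity (#|P|%:R^-1 * \sum_(x in P) (chi A x)^*%R * \sum_y g y * chi A y).
  congr (_ * _); apply: eq_bigr => x _.
  (* After [y] becomes [x + y], the conjugate of [chi A x] cancels the factor contributed by [x]. *)
  rewrite [in RHS](reindex_inj (addrI x)) mulr_sumr; apply: eq_bigr => y _ /=.
  by rewrite mulrCA conj_chi -chiD addKr.
(* The character sum over [P] is a natural number, so the conjugation disappears. *)
rewrite -mulr_suml -rmorph_sum /= sum_chi_subgroup // rmorphM /= !conjC_nat.
by rewrite mulrA mulKf // mulrC.
Qed.

Lemma variance_translates (P : {set T}) (g : T -> C) : GRing.zmod_closed P ->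
  let h y := #|P|%:R^-1 * \sum_(x in P) g (x + y) in
  #|T|%:R^-1 * \sum_y `|h y - #|T|%:R^-1 * \sum_z h z| ^+ 2
  = \sum_(A in (annihilator P :\ 0)%SET) `|transform g A| ^+ 2.
Proof.
move=> P_closed h; rewrite variance_transform.
rewrite (bigID (mem (annihilator P))) /= [X in _ + X]big1 ?addr0.
  apply: eq_big => [A|A /andP[_ AP]]; first by rewrite in_setD1 andbC.
  by rewrite transform_translates // AP mulr1.
move=> A /andP[_ /negPf AP].
by rewrite transform_translates // AP mulr0 normr0 expr0n.
Qed.

End FourierAnalysis.

Section RootOfUnity.
Variables (R : realType) (b : nat).
Hypothesis b_gt1 : (1 < b)%N.

Lemma omegaX k : (omega R b) ^+ k =
  cos (2 * pi * k%:R / b%:R) +i* sin (2 * pi * k%:R / b%:R).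
Proof.
rewrite /omega /expC /= expR0 mul1r.
elim: k => [|k IHk]; first by rewrite expr0 mulr0 mul0r cos0 sin0.
rewrite exprS IHk -(nat1r k) [2 * pi * (1 + _)]mulrDr mulr1 mulrDl cosD sinD.
by apply/eqP; rewrite eq_complex /= [X in _ && (_ == X)]addrC mulrC !eqxx.
Qed.

Lemma omega_expb : (omega R b) ^+ b = 1.
Proof.
have b_neq0 : b%:R != 0 :> R by rewrite pnatr_eq0 -lt0n ltnW.
by rewrite omegaX mulfK // mulr_natl cos2pi sin2pi.
Qed.

Lemma omegaX_neq1 k : (0 < k < b)%N -> (omega R b) ^+ k != 1.
Proof.
move=> /andP[k_gt0 k_ltb]; rewrite omegaX eq_complex /= negb_and.
have b_gt0 : 0 < b%:R :> R by rewrite ltr0n ltnW.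
(* Half of the argument of the power: it lies strictly between 0 and [pi], where the sine is
   positive. *)
set t : R := pi * k%:R / b%:R.
have -> : 2 * pi * k%:R / b%:R = t *+ 2 by rewrite -!mulrA mulr_natl mulrA.
have t_pi : 0 < t < pi.
  apply/andP; split; first by rewrite divr_gt0 // mulr_gt0 ?pi_gt0 ?ltr0n.
  by rewrite /t ltr_pdivrMr // ltr_pM2l ?pi_gt0 // ltr_nat.
(* The real part alone suffices: it equals [1 - 2 sin(t)^2], which is 1 only if [sin t = 0]. *)
apply/orP; left; rewrite cos_mulr2n cos2sin2.
have /lt0r_neq0 := sin_gt0_pi t_pi; apply: contra => /eqP h.
by rewrite -sqrf_eq0; apply/eqP; lra.
Qed.

End RootOfUnity.

Section Bullet.
Variables (R : realType) (b s n : nat).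
Hypothesis b_gt1 : (1 < b)%N.
Implicit Types A B : 'M['Z_b]_(s, n).

(** [bullet] multiplies representatives as natural numbers, while addition in ['Z_b] reduces modulo
    [b]; this reconciles the two. *)
Lemma omegaX_mod k : omega R b ^+ (k %% b) = omega R b ^+ k.
Proof.
by rewrite [in RHS](divn_eq k b) exprD mulnC exprM omega_expb ?expr1n ?mul1r.
Qed.

Lemma bulletE A B : bullet R A B = \prod_i \prod_j omega R b ^+ (A i j * B i j).
Proof.
by rewrite /bullet expr_sum; apply: eq_bigr => i _; rewrite expr_sum.
Qed.

Lemma bulletC A B : bullet R A B = bullet R B A.
Proof.
by rewrite !bulletE; apply: eq_bigr => i _; apply: eq_bigr => j _; rewrite mulnC.
Qed.

Lemma bulletD A : {morph bullet R A : B1 B2 / B1 + B2 >-> B1 * B2}.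
Proof.
move=> B1 B2; rewrite !bulletE -big_split; apply: eq_bigr => i _ /=.
rewrite -big_split; apply: eq_bigr => j _ /=.
rewrite -exprD -mulnDr mxE /= -[LHS]omegaX_mod -[RHS]omegaX_mod.
(* The modulus built into ['Z_b] is a truncated successor form, equal to [b] because [b > 1]. *)
by rewrite [in X in (_ * (_ %% X))%N]Zp_cast // modnMmr.
Qed.

(** The modulus of [omega] is a nonnegative number whose [b]-th power is 1. *)
Lemma norm_bullet A B : `|bullet R A B| = 1.
Proof.
rewrite /bullet normrX; suff -> : `|omega R b| = 1 by rewrite expr1n.
apply/eqP; rewrite -(@pexpr_eq1 _ _ b) ?(ltnW b_gt1) //.
by rewrite -normrX omega_expb // normr1.
Qed.

Lemma bullet_nondegenerate B : B != 0 -> exists A, bullet R A B != 1.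
Proof.
move=> B0; have [i [j Bij]] : exists i j, B i j != 0.
  apply/not_existsP => h; move/eqP: B0; apply; apply/matrixP => i j.
  by rewrite mxE; apply/eqP/negPn/negP => Bij; apply: (h i); exists j.
(* Pairing with a single unit entry at a nonzero position of [B] isolates [omega ^+ B i j], whose
   exponent lies strictly between 0 and [b]. *)
exists (delta_mx i j).
have -> : bullet R (delta_mx i j) B = omega R b ^+ B i j.
  rewrite bulletE (bigD1 i) //= (bigD1 j) //= !mxE !eqxx /= mul1n.
  rewrite !big1 ?mulr1 // => [i' /negPf i'i|j' /negPf j'j].
    by rewrite big1 // => j' _; rewrite mxE i'i /= mul0n.
  by rewrite mxE j'j andbF /= mul0n.
apply: omegaX_neq1 => //; rewrite lt0n Bij /=.
by rewrite -[X in (_ < X)%N]Zp_cast //.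
Qed.

End Bullet.

Theorem corollary1 (R : realType) (b s n : nat)
    (hb : (2 <= b)%N) (hs : (1 <= s)%N) (hn : (1 <= n)%N)
    (P : {set 'M['Z_b]_(s, n)}) (hP : GRing.zmod_closed P)
    (f : 'rV[R]_s -> R)
    (hf : Riemann_integrable f (const_mx 0) (const_mx 1)) :
  (unif_variance (fun sigma : 'M['Z_b]_(s, n) =>
      QMC P sigma (discretization f)))%:C
  = \sum_(A in (dual R P :\ 0)%SET) `|Fourier (discretization f) A| ^+ 2.
Proof.
set g := discretization f.
have FourierE A : Fourier g A =
    transform _ _ (@bullet R b s n) (fun B => (g B)%:C) A.
  have card_mxZ : #|{: 'M['Z_b]_(s, n)}| = (b ^ (s * n))%N.
    by rewrite card_mx card_ord Zp_cast.
  by rewrite /Fourier /transform card_mxZ natrX.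
have QMC_E sigma : (QMC P sigma g)%:C =
    #|P|%:R^-1 * \sum_(x in P) (g (x + sigma))%:C.
  by rewrite /QMC rmorphM rmorph_sum fmorphV rmorph_nat.
under eq_bigr do rewrite FourierE.
(* [dual] unfolds to [annihilator] for the kernel [bullet], so the abstract identity applies to the
   complex-valued copy of [g]. *)
rewrite -(variance_translates _ _ _ (@bulletC R b s n) (@bulletD R b s n hb)
  (@norm_bullet R b s n hb) (@bullet_nondegenerate R b s n hb) _ _ hP).
rewrite /unif_variance /unif_mean rmorphM rmorph_sum fmorphV rmorph_nat /=.
congr (_ * _); apply: eq_bigr => y _.
rewrite rmorphXn rmorphB rmorphM rmorph_sum fmorphV rmorph_nat /= -QMC_E.
under [in RHS]eq_bigr do rewrite -QMC_E.
(* The deviation from the mean is folded back into one embedded real, whose squared modulus is its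
   square. *)
rewrite -(rmorph_nat (real_complex R)) -fmorphV -rmorph_sum -rmorphM -rmorphB.
by rewrite sqr_normc conjc_real expr2.
Qed.
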